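(* Let $p\in[1,\infty]$ and let $Q=\Upsilon(B^n_p)\subset\mathbb{R}^n$ be an $l_p$-ellipsoid with $\Upsilon\in\mathrm{GL}(n,\mathbb{R})$. If $n=1$ then $\mathrm{Vol}(Q\times Q^\circ)=\mathrm{Vol}(Q)\mathrm{Vol}(Q^\circ)=4$ for all $p\in[1,\infty]$. If $n\ge2$ then $$\mathrm{Vol}(Q\times Q^\circ)=\mathrm{Vol}(Q)\mathrm{Vol}(Q^\circ)\ge\frac{4^n}{n!}$$ for all $p\in[1,\infty]$, and equality holds if and only if $p=1$ or $p=\infty$.
   Context: $B^n_p=\{x\in\mathbb{R}^n\mid\|x\|_p<1\}$ is the open unit ball of the $l_p$-norm $\|x\|_p=(\sum_i|x_i|^p)^{1/p}$ for $p<\infty$, $\|x\|_\infty=\max_i|x_i|$. The polar of $Q\subset\mathbb{R}^n$ is $Q^\circ=\{x\in\mathbb{R}^n\mid\langle y,x\rangle\le1\ \forall y\in Q\}$, with $\langle\cdot,\cdot\rangle$ the Euclidean inner product. $\mathrm{Vol}$ is Euclidean volume. *)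

(* Defs.v *)
From HB Require Import structures.
From mathcomp Require Import all_boot all_order all_algebra.
From mathcomp Require Import all_classical all_reals all_analysis.

Set Implicit Arguments.
Unset Strict Implicit.
Unset Printing Implicit Defensive.

Import Order.TTheory GRing.Theory Num.Theory.
Import numFieldNormedType.Exports.

Local Open Scope classical_set_scope.
Local Open Scope ring_scope.

(* The n-fold product of the Lebesgue measure of R, on the product
   sigma-algebra of n.-tuple R, by recursion along R^(n+1) = R * R^n. *)
Fixpoint lebesgue_tuple (R : realType) (n : nat) :
    set (n.-tuple (measurableTypeR R)) -> \bar R :=
  match n with
  | 0 => \d_([tuple] : 0.-tuple (measurableTypeR R))
  | m.+1 => pushforward
      ((@lebesgue_measure R : set (measurableTypeR R) -> \bar R)
         \x @lebesgue_tuple R m)%E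
      (fun z : measurableTypeR R * m.-tuple (measurableTypeR R) =>
         [tuple of z.1 :: z.2])
  end.

(* R^n is represented by column vectors. *)
Definition vol (R : realType) (n : nat) (A : set 'cV[R]_n) : \bar R :=
  @lebesgue_tuple R n [set t | A (\col_i tnth t i)].

(* Only the values p >= 1 are meaningful; the value at -oo is junk. *)
Definition lp_norm (R : realType) (n : nat) (p : \bar R) (x : 'cV[R]_n) : R :=
  match p with
  | r%:E => (\sum_(i < n) `|x i 0| `^ r) `^ r^-1
  | +oo%E => \big[Num.max/0]_(i < n) `|x i 0|
  | -oo%E => 0
  end.

Definition lp_ball (R : realType) (n : nat) (p : \bar R) : set 'cV[R]_n :=
  [set x | lp_norm p x < 1].

Definition dotp (R : realType) (n : nat) (y x : 'cV[R]_n) : R :=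
  \sum_(i < n) y i 0 * x i 0.

Definition polar (R : realType) (n : nat) (Q : set 'cV[R]_n) : set 'cV[R]_n :=
  [set x | forall y, Q y -> dotp y x <= 1].

(* The Cartesian product A x B, inside R^(m + n). *)
Definition cprod (R : realType) (m n : nat)
    (A : set 'cV[R]_m) (B : set 'cV[R]_n) : set 'cV[R]_(m + n) :=
  [set z | A (usubmx z) /\ B (dsubmx z)].

(* Main.v *)
Require Import Defs.
From HB Require Import structures.
From mathcomp Require Import all_boot all_order all_algebra.
From mathcomp Require Import all_classical all_reals all_analysis.
From mathcomp Require Import measurable_realfun.
From mathcomp Require Import ring lra.

Set Implicit Arguments.
Unset Strict Implicit.
Unset Printing Implicit Defensive.

Import Order.TTheory GRing.Theory Num.Theory.
Import numFieldNormedType.Exports.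

Local Open Scope classical_set_scope.
Local Open Scope ring_scope.

(** The linear map cancels: [Q] is the preimage of the unit ball of the l_p norm
    under the inverse of [Y], its polar is the preimage of the closed unit ball
    of the dual l_q norm under the transpose of [Y] (Hoelder duality,
    [polar_lp_ball]), and linear maps multiply volumes by the absolute value of
    the determinant ([vol_affine]).  A closed ball has the volume of the open one
    by scaling ([vol_closed_lp_ball]), so the volume product of [Q] is V_n(p)
    V_n(q), where V_n(p) is the volume of the l_p unit ball.

    Slicing the ball perpendicularly to the first axis gives
      V_(k+1)(p) = 2 V_k(p) I_k(p),
      I_k(p) = the integral over 0 < t < 1 of (1 - t^p)^(k/p)
    ([vol_lp_ballS]).  The whole inequality rests on the one-dimensional bound
      I_k(p) >= (k + 1)^(-1/p)
    ([slice_integral_ge]): multiplied over k < n it reads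
    V_n(p) >= 2^n (n!)^(-1/p), and since 1/p + 1/q = 1 the lower bounds for
    V_n(p) and V_n(q) have product 4^n / n!.  The bound is an equality for p = 1, and V_n is
    2^n for p = oo, which gives the two equality cases; for 1 < p < oo it is
    strict as soon as k >= 1 ([slice_integral_gt]), a factor that is present when
    n >= 2.  For n = 1 only I_0 = 1 occurs and the product is 2 * 2.

    To prove the one-dimensional bound put a = 1/p and m = k + 1, and substitute
      t = (1 - u)^a (1 - u^m)^(1 - a),   0 < u < 1.
    This is the Prekopa-Leindler transport that interpolates between the trivial
    case a = 0, in which the integral is 1, and the explicit case a = 1.  On the
    one hand 1 - t^p >= u, because t^p <= 1 - u.  On the other hand the
    logarithmic derivative of t is a weighted arithmetic mean, so that by the
    weighted arithmetic-geometric inequality - dt/du >= (m u^k)^(1 - a).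
    Therefore the integrand in u is at least m^(1 - a) u^k, whose integral is
    m^(-a). *)

(** * Volume as an iterated integral *)

Section VolumeRecursion.
Context {R : realType}.
Local Notation mR := (measurableTypeR R).
Local Notation mT n := (n.-tuple (measurableTypeR R)).
Local Notation mu := (@lebesgue_measure R).
Local Notation lam := (@lebesgue_tuple R).

Definition tuple_cons n (z : mR * mT n) : mT n.+1 := [tuple of z.1 :: z.2].
Definition tuple_uncons n (t : mT n.+1) : mR * mT n :=
  (thead t, [tuple of behead t]).

Lemma measurable_tuple_cons n : measurable_fun setT (@tuple_cons n).
Proof. exact: measurable_cons. Qed.

Lemma measurable_tuple_uncons n : measurable_fun setT (@tuple_uncons n).
Proof.
apply/measurable_fun_pairP.
split.
- exact: measurable_tnth.
- exact: measurable_behead.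
Qed.

Lemma tuple_consK n : cancel (@tuple_cons n) (@tuple_uncons n).
Proof. by case=> x t; congr pair; exact/val_inj. Qed.

(** [lebesgue_tuple] is a recursion on bare set functions; the measure laws and
    sigma-finiteness have to be carried together through the induction, because
    the product of two measures is a measure only for a sigma-finite second
    factor. *)
Lemma lebesgue_tuple_measure n :
  exists m : {sigma_finite_measure set (mT n) -> \bar R},
    (m : set (mT n) -> \bar R) = @lebesgue_tuple R n.
Proof.
elim: n => [|n [m mE]].
  by exists (\d_([tuple] : mT 0)).
(* The measure structure of a pushforward depends on a proof of measurability
   which unification cannot guess, hence the explicit instance. *)
pose P := measure_function_pushforward__canonical__measure_function_Measure
   ((mu \x m)%E : {measure set _ -> \bar R}) (@measurable_tuple_cons n).
have sP : sigma_finite setT P.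
  have /sigma_finiteP[F [FT ndF Ffin]] := sigma_finiteT mu.
  have /sigma_finiteP[G [GT ndG Gfin]] := sigma_finiteT m.
  exists (fun k => @tuple_uncons n @^-1` (F k `*` G k)).
    rewrite -preimage_bigcup (_ : \bigcup_k _ = setT) ?preimage_setT//.
    apply/seteqP; split=> // -[x t] _.
    have [i _ Fi] : (\bigcup_k F k) x by rewrite -FT.
    have [j _ Gj] : (\bigcup_k G k) t by rewrite -GT.
    exists (maxn i j) => //; split => /=.
    - by move: x Fi; apply/subsetPset/ndF/leq_maxl.
    - by move: t Gj; apply/subsetPset/ndG/leq_maxr.
  move=> k; have [mF Fk] := Ffin k; have [mG Gk] := Gfin k.
  have mFG := measurableX mF mG.
  split.
    by rewrite -[X in measurable X]setTI; exact: measurable_tuple_uncons.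
  rewrite /P/= /pushforward -comp_preimage.
  rewrite (_ : _ \o _ = id); last by apply/funext => z; rewrite /= tuple_consK.
  by rewrite product_measure1E// lte_mul_pinfty// ge0_fin_numE.
pose Q := HB.pack_for {sigma_finite_measure set (mT n.+1) -> \bar R}
  (P : set _ -> _) (Measure.on P) (Measure_isSigmaFinite.Build _ _ _ P sP).
exists Q.
by rewrite /= /P -mE.
Qed.

Section instances.
Variable n : nat.

Let lam0 : @lebesgue_tuple R n set0 = 0%E :> \bar R.
Proof. by have [m <-] := lebesgue_tuple_measure n; exact: measure0. Qed.

Let lam_ge0 (A : set (mT n)) : (0 <= @lebesgue_tuple R n A)%E.
Proof. by have [m <-] := lebesgue_tuple_measure n; exact: measure_ge0. Qed.

Let lam_sigma_additive : semi_sigma_additive (@lebesgue_tuple R n).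
Proof.
have [m <-] := lebesgue_tuple_measure n; exact: measure_semi_sigma_additive.
Qed.

HB.instance Definition _ := isMeasure.Build _ (mT n) R (@lebesgue_tuple R n)
  lam0 lam_ge0 lam_sigma_additive.

Let lam_sigma_finite : sigma_finite setT (@lebesgue_tuple R n).
Proof. have [m <-] := lebesgue_tuple_measure n; exact: sigma_finiteT. Qed.

HB.instance Definition _ := Measure_isSigmaFinite.Build _ (mT n) R
  (@lebesgue_tuple R n) lam_sigma_finite.
End instances.

Definition col_of_tuple n (t : mT n) : 'cV[R]_n := \col_i tnth t i.

(** Column vectors carry no sigma-algebra, so the one of tuples is transported to
    them. *)
Definition measurable_col n (A : set 'cV[R]_n) :=
  measurable (@col_of_tuple n @^-1` A).

Definition col_cons n (x : R) (y : 'cV[R]_n) : 'cV[R]_(1 + n) := col_mx x%:M y.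

Lemma col_of_tuple_cons n (z : mR * mT n) :
  col_of_tuple (tuple_cons z) = col_cons z.1 (col_of_tuple z.2).
Proof.
apply/matrixP => i j; rewrite ord1 /col_cons mxE.
rewrite -[i](@splitK 1 n); case: (fintype.split (i : 'I_(1 + n))) => k /=.
  rewrite [RHS]col_mxEu ord1 mxE eqxx mulr1n (_ : lshift n 0 = ord0) ?tnth0 //.
  exact/val_inj.
rewrite [RHS]col_mxEd mxE /tuple_cons.
by rewrite (_ : rshift 1 k = lift ord0 k) ?tnthS//; exact/val_inj.
Qed.

Lemma measurable_tuple_cons_preimage n (A : set 'cV[R]_n.+1) :
  measurable_col A ->
  measurable [set z : mR * mT n | A (col_cons z.1 (col_of_tuple z.2))].
Proof.
move=> mA.
rewrite (_ : [set _ | _] = @tuple_cons n @^-1` (@col_of_tuple n.+1 @^-1` A)).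
  by rewrite -[X in measurable X]setTI; exact: measurable_tuple_cons.
by apply/funext => z; rewrite /= col_of_tuple_cons.
Qed.

(** The recursion defining [lebesgue_tuple]: the first coordinate is integrated
    last. *)
Lemma vol_integral_head n (A : set 'cV[R]_n.+1) :
  vol A = (\int[mu]_x vol [set y : 'cV[R]_n | A (col_cons x y)])%E.
Proof.
rewrite /vol /= /pushforward /= /product_measure1.
apply: eq_integral => x _ /=; congr lebesgue_tuple.
apply/funext => t; rewrite /xsection /=; apply/propext; split.
  rewrite inE /=; move: (col_of_tuple_cons (x, t)).
  by rewrite /col_of_tuple => <-.
by move: (col_of_tuple_cons (x, t)); rewrite inE /= /col_of_tuple => <-.
Qed.

(** Tonelli: here the first coordinate is integrated first, which is what maps
    acting on the first coordinate alone require. *)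
Lemma vol_integral_tail n (A : set 'cV[R]_n.+1) : measurable_col A ->
  vol A = (\int[lam (n:=n)]_t mu [set x | A (col_cons x (col_of_tuple t))])%E.
Proof.
move=> mA.
have mB := measurable_tuple_cons_preimage mA.
transitivity ((mu \x lam (n:=n))%E
  [set z : mR * mT n | A (col_cons z.1 (col_of_tuple z.2))]).
  rewrite vol_integral_head; apply: eq_integral => x _ /=; congr lebesgue_tuple.
  by rewrite xsectionE.
transitivity ((mu \x^ lam (n:=n))%E
  [set z : mR * mT n | A (col_cons z.1 (col_of_tuple z.2))]).
  apply: product_measure_unique => //.
  by move=> B C mB' mC; rewrite /= product_measure2E.
by apply: eq_integral => t _ /=; rewrite ysectionE.
Qed.

Lemma measurable_vol_slice n (A : set 'cV[R]_n.+1) : measurable_col A ->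
  measurable_fun [set: mR] (fun x => vol [set y : 'cV[R]_n | A (col_cons x y)]).
Proof.
move=> mA.
have := measurable_fun_xsection (lam (n:=n))
  (measurable_tuple_cons_preimage mA).
by apply: eq_measurable_fun => x _ /=; rewrite xsectionE.
Qed.

Lemma measurable_col_slice n (A : set 'cV[R]_n.+1) x : measurable_col A ->
  measurable_col [set y : 'cV[R]_n | A (col_cons x y)].
Proof.
move=> mA.
have := measurable_xsection x (measurable_tuple_cons_preimage mA).
by rewrite xsectionE.
Qed.

Lemma vol_ge0 n (A : set 'cV[R]_n) : (0 <= vol A)%E.
Proof. exact: measure_ge0. Qed.

Lemma vol0 n : vol (@set0 'cV[R]_n) = 0%E.
Proof. exact: measure0. Qed.

Lemma le_vol n (A B : set 'cV[R]_n) : measurable_col A -> measurable_col B ->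
  A `<=` B -> (vol A <= vol B)%E.
Proof.
by move=> mA mB AB; apply: le_measure; rewrite ?inE// => t; exact: AB.
Qed.

Lemma measurable_col_preimage m n
    (f : 'cV[R]_m -> 'cV[R]_n) (A : set 'cV[R]_n) :
  (forall i, measurable_fun [set: mT m] (fun t => f (col_of_tuple t) i 0)) ->
  measurable_col A -> measurable_col [set x | A (f x)].
Proof.
move=> mf mA.
have mF : measurable_fun [set: mT m]
    (fun t => [tuple f (col_of_tuple t) i 0 | i < n] : mT n).
  apply/measurable_fun_tnthP => i.
  rewrite (_ : _ \o _ = (fun t => f (col_of_tuple t) i 0)); first exact: mf.
  by apply/funext => t; rewrite /= tnth_mktuple.
rewrite /measurable_col (_ : _ @^-1` _ =
    (fun t => [tuple f (col_of_tuple t) i 0 | i < n] : mT n)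
    @^-1` (@col_of_tuple n @^-1` A)).
  by rewrite -[X in measurable X]setTI; exact: mF.
apply/funext => t /=; congr A.
by apply/matrixP => i j; rewrite ord1 mxE tnth_mktuple.
Qed.

Lemma measurable_col_of_tuple n (i : 'I_n) :
  measurable_fun [set: mT n] (fun t => col_of_tuple t i 0 : mR).
Proof.
by under eq_fun do rewrite mxE; exact: measurable_tnth.
Qed.

Lemma measurable_col_affine m n (M : 'M[R]_(n, m)) b A : measurable_col A ->
  measurable_col [set x : 'cV[R]_m | A (M *m x + b)].
Proof.
apply: measurable_col_preimage => i.
under eq_fun do rewrite !mxE.
apply: measurable_funD => //.
apply: measurable_sum => j; apply: measurable_funM => //.
exact: measurable_col_of_tuple.
Qed.
End VolumeRecursion.

(** * Affine change of variables *)

Section AffineMaps.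
Context {R : realType}.
Local Notation mR := (measurableTypeR R).
Local Notation mu := (@lebesgue_measure R).

Lemma measurable_fun_affine (a b : R) :
  measurable_fun [set: mR] ((fun x => a * x + b) : mR -> mR).
Proof. by apply: measurable_funD => //; apply: measurable_funM. Qed.

(** Both sides are measures in [A] that agree on half-open intervals. *)
Lemma lebesgue_measure_affine (a b : R) (A : set mR) : a != 0 ->
  measurable A -> (`|a|%:E * mu [set x | A (a * x + b)%R])%E = mu A.
Proof.
move=> a0 mA.
pose P := measure_function_pushforward__canonical__measure_function_Measure
  (mu : {measure set _ -> \bar R}) (@measurable_fun_affine a b).
pose Q : {measure set mR -> \bar R} := mscale (NngNum (normr_ge0 a)) P.
have QE (B : set mR) : Q B = (`|a|%:E * mu [set x | B (a * x + b)%R])%E by [].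
rewrite -QE; apply/esym/lebesgue_measure_unique => // _ [[c d]] _ <-.
rewrite QE /= lebesgue_measure_itv /= lte_fin.
have [a_lt0|a_gt0|/eqP] := ltgtP a 0; last by rewrite (negbTE a0).
- rewrite (_ : [set _ | _] = `[(d - b) / a, (c - b) / a[%classic).
    rewrite lebesgue_measure_itv /= lte_fin ltr_nM2r ?invr_lt0// ltrBlDr subrK.
    case: ifPn => cd; last by rewrite mule0.
    rewrite -!EFinD -EFinM ltr0_norm//; congr EFin; field; exact: a0.
  apply/seteqP; split => x /=; rewrite !in_itv /=.
    by rewrite ler_ndivrMr// ltr_ndivlMr// lerBrDr ltrBlDr mulrC andbC.
  by rewrite ler_ndivrMr// ltr_ndivlMr// lerBrDr ltrBlDr mulrC andbC.
- rewrite (_ : [set _ | _] = `](c - b) / a, (d - b) / a]%classic).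
    rewrite lebesgue_measure_itv /= lte_fin ltr_pM2r ?invr_gt0// ltrBlDr subrK.
    case: ifPn => cd; last by rewrite mule0.
    rewrite -!EFinD -EFinM gtr0_norm//; congr EFin; field; exact: a0.
  apply/seteqP; split => x /=; rewrite !in_itv /=.
    by rewrite ler_pdivlMr// ltr_pdivrMr// lerBrDr ltrBlDr mulrC.
  by rewrite ler_pdivlMr// ltr_pdivrMr// lerBrDr ltrBlDr mulrC.
Qed.

(** Stated with the determinant on the side of the preimage, so that no division
    is needed and the property composes by plain multiplication. *)
Definition affine_scales_vol n (M : 'M[R]_n) (b : 'cV[R]_n) :=
  forall A, measurable_col A ->
  (`|\det M|%:E * vol [set x | A (M *m x + b)%R])%E = vol A.

Lemma affine_scales_vol_comp n (M N : 'M[R]_n) b c :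
  affine_scales_vol M b -> affine_scales_vol N c ->
  affine_scales_vol (M *m N) (M *m c + b).
Proof.
move=> HM HN A mA; rewrite det_mulmx normrM EFinM -muleA -[RHS]HM//.
congr (_ * _)%E; rewrite -[RHS]HN; last exact: measurable_col_affine.
congr (_ * vol _)%E; apply/funext => x /=.
by rewrite mulmxDr mulmxA addrA.
Qed.

(** On the slice of first coordinate [x] the map acts as
    [y |-> D *m y + (x *: c + b)]; this is why the inductive hypothesis must
    cover all translations. *)
Lemma affine_scales_vol_lower n (c : 'cV[R]_n) (D : 'M[R]_n) (b : 'cV[R]_n) :
  (forall b', affine_scales_vol D b') ->
  affine_scales_vol (block_mx 1%:M 0 c D : 'M[R]_(1 + n)) (col_cons 0 b).
Proof.
move=> HD A mA.
rewrite (@det_lblock _ 1 n) det1 mul1r vol_integral_head.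
rewrite [RHS]vol_integral_head -ge0_integralZl//=.
- apply: eq_integral => x _.
  rewrite -[RHS](HD (x *: c + b)); last exact: measurable_col_slice.
  congr (_ * vol _)%E; apply/funext => y /=; congr A.
  rewrite /col_cons mul_block_col add_col_mx mul0mx addr0 mul1mx.
  by rewrite mul_mx_scalar (addrCA (D *m y)) addrA raddf0 addr0.
- exact: (measurable_vol_slice (measurable_col_affine _ _ mA)).
Qed.

(** On a line parallel to the first axis the map acts as an affine map of the
    line with slope [a]. *)
Lemma affine_scales_vol_upper n (a : R) (r : 'rV[R]_n) (b : R) :
  a != 0 ->
  affine_scales_vol (block_mx a%:M r 0 1%:M : 'M[R]_(1 + n)) (col_cons b 0).
Proof.
move=> a0 A mA.
rewrite (@det_ublock _ 1 n) det1 mulr1 det_mx11 mxE eqxx mulr1n.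
rewrite vol_integral_tail ?[RHS]vol_integral_tail//; last first.
  exact: measurable_col_affine.
rewrite -ge0_integralZl//=.
- apply: eq_integral => t _.
  rewrite -[RHS](@lebesgue_measure_affine a
    ((r *m col_of_tuple t) 0 0 + b)) //; last first.
    have := measurable_ysection t (measurable_tuple_cons_preimage mA).
    by rewrite ysectionE.
  congr (_ * mu _)%E; apply/funext => x /=; congr A.
  rewrite /col_cons mul_block_col add_col_mx mul0mx add0r mul1mx addr0.
  congr col_mx; apply/matrixP => i j; rewrite !ord1 !mxE /= !mulr1n.
  by rewrite big_ord1 !mxE eqxx !mulr1n addrA.
- apply: eq_measurable_fun (measurable_fun_ysection mu
    (measurable_tuple_cons_preimage (measurable_col_affine _ _ mA))).
  by move=> t _ /=; rewrite ysectionE.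
Qed.

(** If the top left entry is nonzero, one step of Gaussian elimination factors the
    matrix into the two block shapes above.  If it is zero, the first column still
    has a nonzero entry; the shear adding that row to the first one has
    determinant 1 and reduces to the previous case. *)
Theorem vol_affine n (M : 'M[R]_n) b : M \in unitmx -> affine_scales_vol M b.
Proof.
elim: n => [|n IH] in M b *.
  move=> _ A mA; rewrite det_mx00 normr1 mul1e; congr vol.
  by apply/funext => x /=; congr A; apply/matrixP => -[].
have main (N : 'M[R]_(1 + n)) c : N \in unitmx -> N 0 0 != 0 ->
    affine_scales_vol N c.
  move=> uN N00.
  pose a := N 0 0; pose r := ursubmx N; pose l := dlsubmx N.
  pose S := drsubmx N - a^-1 *: (l *m r).
  pose L : 'M[R]_(1 + n) := block_mx 1%:M 0 (a^-1 *: l) S.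
  pose U : 'M[R]_(1 + n) := block_mx a%:M r 0 1%:M.
  have NLU : N = L *m U.
    rewrite -[N in LHS]submxK mulmx_block !mul1mx !mul0mx !mulmx0 !mulmx1 !addr0.
    rewrite mul_mx_scalar scalerA mulfV// scale1r -scalemxAl addrCA subrr addr0.
    congr block_mx; apply/matrixP => i j; rewrite !ord1 !mxE eqxx mulr1n.
    by congr (N _ _); exact/val_inj.
  have uS : S \in unitmx.
    move: uN; rewrite unitmxE NLU det_mulmx (@det_lblock _ 1 n) det1 mul1r.
    by rewrite unitrM => /andP[]; rewrite -unitmxE.
  pose c0 := usubmx c 0 0.
  have -> : c = L *m col_cons c0 0 + col_cons 0 (dsubmx c - a^-1 *: l *m c0%:M).
    rewrite /col_cons mul_block_col !mul0mx mulmx0 mul1mx !addr0 add_col_mx raddf0.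
    rewrite addr0 addrC subrK -[LHS]vsubmxK; congr col_mx.
    by apply/matrixP => i j; rewrite !ord1 [RHS]mxE eqxx mulr1n.
  rewrite NLU; apply: affine_scales_vol_comp.
    by apply: affine_scales_vol_lower => b'; exact: IH.
  exact: affine_scales_vol_upper.
move=> uM.
have [M00|] := eqVneq (M 0 0) 0; last exact: main.
have [i Mi0] : exists i : 'I_n, (dlsubmx (M : 'M[R]_(1 + n))) i 0 != 0.
  apply/not_existsP => H; move: uM; rewrite unitmxE.
  suff -> : \det M = 0 by rewrite unitr0.
  rewrite (expand_det_col _ ord0) big1// => k _.
  rewrite (_ : M k ord0 = 0) ?mul0r//.
  rewrite -[k](@splitK 1 n); case: (fintype.split (k : 'I_(1 + n))) => j /=.
    by rewrite ord1 -[RHS]M00; congr (M _ _); exact/val_inj.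
  have /negP/negPn/eqP := H j; rewrite !mxE => <-.
  by congr (M _ _); exact/val_inj.
pose E (s : R) : 'M[R]_(1 + n) := block_mx 1%:M (s *: delta_mx 0 i) 0 1%:M.
have EE : E (-1) *m E 1 = 1%:M.
  rewrite mulmx_block !mul1mx !mul0mx !mulmx0 !mulmx1 !addr0 add0r.
  by rewrite scaleN1r scale1r subrr -(@scalar_mx_block _ 1 n).
rewrite -[M]mul1mx -[b]mul1mx -EE -2!mulmxA -[_ *m (E 1 *m b)]addr0.
rewrite -[X in _ + X](_ : col_cons 0 0 = 0 :> 'cV[R]_(1 + n)); last first.
  by rewrite /col_cons raddf0 col_mx0.
apply: affine_scales_vol_comp.
  exact: affine_scales_vol_upper (oner_neq0 _).
apply: main.
  rewrite unitmx_mul uM andbT unitmxE (@det_ublock _ 1 n) !det1 mulr1.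
  exact: unitr1.
have ul0 : ulsubmx (M : 'M[R]_(1 + n)) 0 0 = 0.
  by rewrite !mxE -[RHS]M00; congr (M _ _); exact/val_inj.
rewrite -[M](@submxK _ 1 n 1 n) /E (@mulmx_block _ 1 n 1 n 1 n).
rewrite (_ : (0 : 'I_n.+1) = (lshift n (0 : 'I_1) : 'I_(1 + n))); last exact/val_inj.
rewrite (@block_mxEul _ 1 n 1 n) mul1mx scale1r -rowE.
by rewrite [X in X != 0]mxE ul0 add0r [X in X != 0]mxE.
Qed.
End AffineMaps.

(** * Products of sets and l_p norms *)

Section ProductsAndNorms.
Context {R : realType}.

Lemma usubmx_col_cons m n (x : R) (y : 'cV[R]_(m + n)) :
  usubmx (col_cons x y : 'cV[R]_(m.+1 + n)) = col_cons x (usubmx y).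
Proof.
apply/matrixP => i j; rewrite mxE ord1 -[i](@splitK 1 m).
case: (fintype.split (i : 'I_(1 + m))) => k /=.
  have -> : lshift n (lshift m k : 'I_m.+1) =
      (lshift (m + n) k : 'I_(1 + (m + n))).
    exact/val_inj.
  by rewrite [RHS]col_mxEu [LHS]col_mxEu.
have -> : lshift n (rshift 1 k : 'I_m.+1) =
    (rshift 1 (lshift n k) : 'I_(1 + (m + n))).
  exact/val_inj.
by rewrite [RHS]col_mxEd [LHS]col_mxEd mxE.
Qed.

Lemma dsubmx_col_cons m n (x : R) (y : 'cV[R]_(m + n)) :
  dsubmx (col_cons x y : 'cV[R]_(m.+1 + n)) = dsubmx y.
Proof.
apply/matrixP => i j; rewrite mxE ord1.
have -> : rshift m.+1 i = (rshift 1 (rshift m i) : 'I_(1 + (m + n))).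
  exact/val_inj.
by rewrite [LHS]col_mxEd mxE.
Qed.

Lemma vol_cprod m n (A : set 'cV[R]_m) (B : set 'cV[R]_n) :
  measurable_col A -> measurable_col B -> vol (cprod A B) = (vol A * vol B)%E.
Proof.
move=> + mB; elim: m A => [A _|m IH A mA].
  have dsub0 (z : 'cV[R]_(0 + n)) : dsubmx z = z.
    by apply/matrixP => i j; rewrite mxE; congr (z _ _); exact/val_inj.
  have [A0|A0] := pselect (A 0).
    rewrite (_ : cprod A B = B); last first.
      apply/seteqP; split => z; rewrite /cprod/= dsub0; first by case.
      move=> Bz; split => //; rewrite (_ : usubmx z = 0)//.
      by apply/matrixP => -[].
    rewrite (_ : A = setT); last first.
      apply/seteqP; split => // z _; rewrite (_ : z = 0)//.
      by apply/matrixP => -[].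
    by rewrite /vol /= diracT mul1e.
  rewrite (_ : A = set0); last first.
    apply/seteqP; split => // z; rewrite (_ : z = 0)//.
    by apply/matrixP => -[].
  rewrite (_ : cprod _ _ = set0) ?vol0 ?mul0e//.
  by apply/seteqP; split => // z [].
rewrite [in RHS]vol_integral_head (@vol_integral_head _ (m + n)) -ge0_integralZr//.
- apply: eq_integral => x _; rewrite -IH; last exact: measurable_col_slice.
  congr vol; apply/funext => y.
  by rewrite /cprod /= usubmx_col_cons dsubmx_col_cons.
- exact: measurable_vol_slice.
Qed.

Lemma lp_normZ n (p : \bar R) (c : R) (x : 'cV[R]_n) : (1 <= p)%E -> 0 <= c ->
  lp_norm p (c *: x) = c * lp_norm p x.
Proof.
case: p => [r|_|] //= => [|] c0; last first.
  rewrite (big_morph (fun y => c * y) (id1 := 0) (op1 := Num.max)).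
  - by apply: eq_bigr => i _; rewrite mxE normrM ger0_norm.
  - by move=> y z; rewrite maxr_pMr.
  - by rewrite mulr0.
rewrite lee_fin in c0; move=> c1.
have r0 : 0 < r by exact: lt_le_trans c0.
rewrite (eq_bigr (fun i => c `^ r * `|x i 0| `^ r)); last first.
  by move=> i _; rewrite mxE normrM ger0_norm// powRM.
rewrite -mulr_sumr powRM ?powR_ge0//; last first.
  by apply: sumr_ge0 => i _; exact: powR_ge0.
by rewrite -powRrM mulfV ?gt_eqF// powRr1.
Qed.

Lemma lp_norm_lt n (r c : R) (x : 'cV[R]_n) : 0 < r -> 0 < c ->
  (lp_norm r%:E x < c) = (\sum_i `|x i 0| `^ r < c `^ r).
Proof.
move=> r0 c0 /=; set s := \sum_i _.
have s0 : 0 <= s by apply: sumr_ge0 => i _; exact: powR_ge0.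
have cE : c = (c `^ r) `^ r^-1 by rewrite -powRrM mulfV ?gt_eqF// powRr1// ltW.
have rV : 0 < r^-1 by rewrite invr_gt0.
rewrite [in LHS]cE; apply/idP/idP => H.
  rewrite ltNge; apply: contraTN H => H; rewrite -leNgt.
  by apply: ge0_ler_powR; rewrite ?nnegrE ?powR_ge0// ltW.
by apply: gt0_ltr_powR; rewrite ?nnegrE ?powR_ge0.
Qed.

Lemma lp_norm_le1 n (r : R) (x : 'cV[R]_n) : 0 < r ->
  (lp_norm r%:E x <= 1) = (\sum_i `|x i 0| `^ r <= 1).
Proof.
move=> r0 /=; set s := \sum_i _.
have s0 : 0 <= s by apply: sumr_ge0 => i _; exact: powR_ge0.
have rV : 0 < r^-1 by rewrite invr_gt0.
have E1 : 1 = 1 `^ r^-1 :> R by rewrite powR1.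
rewrite [X in _ <= X = _]E1; apply/idP/idP => H.
  rewrite leNgt; apply: contraTN H => H; rewrite -ltNge.
  by apply: gt0_ltr_powR; rewrite ?nnegrE.
by apply: ge0_ler_powR; rewrite ?nnegrE// ltW.
Qed.

Lemma sup_norm_lt n (c : R) (x : 'cV[R]_n) : 0 < c ->
  (lp_norm +oo%E x < c) = [forall i, `|x i 0| < c].
Proof.
move=> c0 /=; apply/idP/forallP => [H i|H].
  by apply: le_lt_trans H; exact: (le_bigmax _ (fun i => `|x i 0|)).
by apply/bigmax_ltP; split => // i _; exact: H.
Qed.

Lemma sup_norm_le1 n (x : 'cV[R]_n) :
  (lp_norm +oo%E x <= 1) = [forall i, `|x i 0| <= 1].
Proof.
apply/idP/forallP => [H i|H].
  by apply: le_trans H; exact: (le_bigmax _ (fun i => `|x i 0|)).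
by apply/bigmax_leP; split => // i _; exact: H.
Qed.
End ProductsAndNorms.

(** * Volumes of l_p balls *)

Section BallVolumes.
Context {R : realType}.
Local Notation mR := (measurableTypeR R).
Local Notation mT n := (n.-tuple (measurableTypeR R)).
Local Notation mu := (@lebesgue_measure R).

Lemma powR1r (e : R) : 1 `^ e = 1.
Proof. by rewrite powR1. Qed.

Lemma measurable_lp_norm n (p : \bar R) :
  measurable_fun [set: mT n] (fun t => lp_norm p (col_of_tuple t) : mR).
Proof.
have mabs (i : 'I_n) :
    measurable_fun [set: mT n] (fun t => `|col_of_tuple t i 0| : mR).
  by apply: measurableT_comp => //; exact: measurable_col_of_tuple.
case: p => [r| |] /=; last exact: measurable_cst.
- apply: (measurableT_comp (@measurable_powR R r^-1)).
  apply: measurable_sum => i.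
  exact: (measurableT_comp (@measurable_powR R r) (mabs i)).
- elim: (index_enum _) => [|i s IH].
    by under eq_fun do rewrite big_nil; exact: measurable_cst.
  under eq_fun do rewrite big_cons.
  exact: (measurable_maxr (mabs i) IH).
Qed.

Lemma measurable_col_lp_lt n p c :
  measurable_col [set x : 'cV[R]_n | lp_norm p x < c].
Proof.
have := @measurable_lp_norm n p measurableT _ (measurable_itv `]-oo, c[).
by rewrite setTI; congr measurable; apply/funext => t; rewrite /= in_itv.
Qed.

Lemma measurable_col_lp_le n p c :
  measurable_col [set x : 'cV[R]_n | lp_norm p x <= c].
Proof.
have := @measurable_lp_norm n p measurableT _ (measurable_itv `]-oo, c]).
by rewrite setTI; congr measurable; apply/funext => t; rewrite /= in_itv.
Qed.

Lemma vol_lp_lt n (p : \bar R) s : (1 <= p)%E -> 0 < s ->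
  vol [set x : 'cV[R]_n | lp_norm p x < s] =
  ((s ^+ n)%:E * vol (@lp_ball R n p))%E.
Proof.
move=> p1 s0.
have uM : (s%:M : 'M[R]_n) \in unitmx.
  by rewrite unitmxE det_scalar unitfE expf_neq0// gt_eqF.
rewrite -(vol_affine 0 uM) ?det_scalar; last exact: measurable_col_lp_lt.
rewrite ger0_norm ?exprn_ge0// 1?ltW//; congr (_ * vol _)%E.
apply/funext => x /=; rewrite addr0 mul_scalar_mx lp_normZ//; last exact: ltW.
rewrite /lp_ball /=.
by rewrite -[X in _ < X](mulr1 s) ltr_pM2l.
Qed.

(** The closed ball lies in the open ball of any radius [s > 1], whose volume is
    [s ^+ n] times that of the unit ball; let [s] tend to 1. *)
Lemma vol_closed_lp_ball n (p : \bar R) : (1 <= p)%E ->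
  vol [set x : 'cV[R]_n | lp_norm p x <= 1] = vol (@lp_ball R n p).
Proof.
move=> p1; apply/eqP; rewrite eq_le; apply/andP; split; last first.
  apply: le_vol; [exact: measurable_col_lp_lt|exact: measurable_col_lp_le|].
  by move=> x; exact: ltW.
apply/lee_mul01Pr => [|c /andP[c0 c1]]; first exact: vol_ge0.
(* The exponent uses n + 1 rather than n to include dimension 0. *)
pose s := c^-1 `^ n.+1%:R^-1.
have cV1 : 1 < c^-1 by rewrite invf_gt1.
have s1 : 1 < s.
  rewrite -(powR1r (n.+1%:R^-1 : R)); apply: gt0_ltr_powR; rewrite ?nnegrE//.
  by rewrite ltW// invr_gt0.
have s0 : 0 < s by exact: lt_trans s1.
have sn : s ^+ n <= c^-1.
  have -> : c^-1 = s ^+ n.+1.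
    rewrite -powR_mulrn ?ltW// /s -powRrM mulVf ?pnatr_eq0// powRr1//.
    by rewrite invr_ge0 ltW.
  by rewrite exprS ler_peMl ?exprn_ge0// ltW.
apply: (@le_trans _ _ (c%:E * ((s ^+ n)%:E * vol (@lp_ball R n p)))%E).
  rewrite lee_pmul2l// -vol_lp_lt//; apply: le_vol.
  - exact: measurable_col_lp_le.
  - exact: measurable_col_lp_lt.
  - by move=> x /= /le_lt_trans; exact.
rewrite muleA -EFinM -[leRHS]mul1e; apply: lee_pmul => //.
- by rewrite lee_fin mulr_ge0 ?exprn_ge0// ltW.
- by rewrite lee_fin -ler_pdivlMl// mulr1.
Qed.

(** The factor by which the slice of the (n + 1)-dimensional unit ball at height
    [t] is smaller than the n-dimensional unit ball: the n-th power of the radius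
    of that slice. *)
Definition slice_factor n (r t : R) : R := ((1 - `|t| `^ r) `^ r^-1) ^+ n.

Lemma measurable_slice_factor n r D :
  measurable_fun (D : set mR) (EFin \o slice_factor n r).
Proof.
apply/measurable_EFinP; apply: measurable_funTS.
apply: measurable_funX.
apply: (measurableT_comp (@measurable_powR R r^-1)).
apply: measurable_funB => //.
apply: (measurableT_comp (@measurable_powR R r)).
exact: normr_measurable.
Qed.

Lemma slice_factor_ge0 n r t : 0 <= slice_factor n r t.
Proof. by rewrite exprn_ge0// powR_ge0. Qed.

(** For [|t| < 1] the slice of the ball at height [t] is a ball of radius
    [(1 - |t|^r)^(1/r)]; the other slices are empty. *)
Lemma vol_lp_ballS n (r : R) : 1 <= r ->
  vol (@lp_ball R n.+1 r%:E) =
  ((\int[mu]_(t in `](-1)%R, 1%R[%classic) (slice_factor n r t)%:E) *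
   vol (@lp_ball R n r%:E))%E.
Proof.
move=> r1; have r0 : 0 < r by exact: lt_le_trans r1.
rewrite vol_integral_head -ge0_integralZr//; last 2 first.
- exact: measurable_slice_factor.
- by move=> t _; rewrite lee_fin slice_factor_ge0.
rewrite [RHS]integral_mkcond; apply: eq_integral => t _.
rewrite patchE mem_setE in_itv /= -ltr_norml.
have sumE (y : 'cV[R]_n) : \sum_(i < n.+1) `|col_cons t y i 0| `^ r =
    `|t| `^ r + \sum_(i < n) `|y i 0| `^ r.
  rewrite (@big_split_ord _ _ _ 1 n) big_ord1 /=; congr (_ `^ _ + _).
    by rewrite /col_cons col_mxEu mxE eqxx.
  by apply: eq_bigr => i _; rewrite /col_cons col_mxEd.
case: ifPn => t1; last first.
  rewrite (_ : [set _ | _] = set0) ?vol0//.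
  apply/seteqP; split => // y; rewrite /lp_ball /= lp_norm_lt// powR1 sumE.
  apply/negP; rewrite -leNgt -leNgt in t1 *.
  apply: ler_wpDr; first by apply: sumr_ge0 => i _; exact: powR_ge0.
  by rewrite -(powR1r r); apply: ge0_ler_powR; rewrite ?nnegrE// ltW.
have tr : `|t| `^ r < 1.
  by rewrite -(powR1r r); apply: gt0_ltr_powR; rewrite ?nnegrE.
rewrite -vol_lp_lt//; last by rewrite powR_gt0// subr_gt0.
congr vol; apply/funext => y; rewrite /lp_ball /=.
rewrite !lp_norm_lt//; last by rewrite powR_gt0// subr_gt0.
rewrite powR1 sumE -powRrM mulVf ?gt_eqF// powRr1 ?subr_ge0 1?ltW//.
by rewrite ltrBrDl.
Qed.

(** The integrand is even. *)
Lemma integral_slice_factor n r :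
  (\int[mu]_(t in `](-1)%R, 1%R[%classic) (slice_factor n r t)%:E =
   2%:E * \int[mu]_(t in `]0%R, 1%R[%classic) (slice_factor n r t)%:E)%E.
Proof.
rewrite (@itv_bndbnd_setU _ _ _ (BRight 0))//=; last 2 first.
  by rewrite bnd_simp ?ltrN10 ?lerN10 ?lexx ?ltr01 ?ler01.
  by rewrite bnd_simp ?ltrN10 ?lerN10 ?lexx ?ltr01 ?ler01.
rewrite ge0_integral_setU//=; last 3 first.
- exact: measurable_slice_factor.
- by move=> t _; rewrite lee_fin slice_factor_ge0.
- apply/disj_setPS => x /= [] /=.
  by rewrite !in_itv /= => /andP[_ ?] /andP[? _]; lra.
rewrite mule_natl mule2n; congr +%E.
transitivity (\int[pushforward mu (-%R : mR -> mR)]_(t in `](-1)%R, 0%R]%classic)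
    (slice_factor n r t)%:E)%E.
  by apply: eq_measure_integral => A mA _; exact/esym/lebesgue_measureN.
have mN : measurable_fun [set: mR] (-%R : mR -> mR) by exact: oppr_measurable.
have -> := @ge0_integral_pushforward _ _ mR mR R _ mN mu `](-1)%R, 0%R]%classic
  (EFin \o slice_factor n r) (measurable_itv _) (@measurable_slice_factor _ _ _).
  rewrite opp_preimage_itvbndbnd/= oppr0 opprK -integral_itv_obnd_cbnd.
    by apply: eq_integral => t _; rewrite /= /slice_factor normrN.
  rewrite (_ : (fun _ => _) = EFin \o slice_factor n r).
    exact: measurable_slice_factor.
  by apply/funext => t; rewrite /= /slice_factor normrN.
by move=> t _; rewrite lee_fin slice_factor_ge0.
Qed.
End BallVolumes.

(** * Polars of l_p balls *)

Section Polars.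
Context {R : realType}.
Implicit Types (n : nat) (r s : R).

(** The conjugate exponent of [p >= 1]; the value at [-oo] is junk. *)
Definition dual_exp (p : \bar R) : \bar R :=
  match p with
  | r%:E => if r == 1 then +oo%E else (r / (r - 1))%:E
  | _ => 1%E
  end.

Lemma ler_mul01 (x y : R) : 0 <= x ->
  (forall c, 0 < c < 1 -> c * x <= y) -> x <= y.
Proof.
move=> x0 H; rewrite -lee_fin; apply/lee_mul01Pr; first by rewrite lee_fin.
by move=> c c01; rewrite -EFinM lee_fin H.
Qed.

Lemma normr_sg_le1 (x : R) : `|Num.sg x| <= 1.
Proof. by rewrite normr_sg; case: (x != 0). Qed.

Lemma dotp_adjoint n (M : 'M[R]_n) (y x : 'cV[R]_n) :
  dotp (M *m y) x = dotp y (M^T *m x).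
Proof.
rewrite /dotp.
under eq_bigr => i _ do rewrite mxE mulr_suml.
rewrite exchange_big /=; apply: eq_bigr => j _.
rewrite mxE mulr_sumr; apply: eq_bigr => i _.
by rewrite mxE mulrAC mulrA [in RHS]mulrC mulrA [in RHS]mulrC mulrA.
Qed.

(** In each of the three duality lemmas, one inclusion is Hoelder's inequality and
    the other tests [x] against [c] times the vector for which Hoelder is an
    equality.  The factor [c < 1], removed at the end by [ler_mul01], puts that
    vector in the open ball. *)
Lemma polar_lp1 n : polar (@lp_ball R n 1%E) = [set x | lp_norm +oo%E x <= 1].
Proof.
apply/seteqP; split => x; rewrite /polar /= -/(lp_norm +oo%E x) ?sup_norm_le1.
  move=> H; apply/forallP => i; apply: ler_mul01 => // c /andP[c0 c1].
  pose y : 'cV[R]_n := \col_j (if j == i then c * Num.sg (x i 0) else 0).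
  have -> : c * `|x i 0| = dotp y x.
    rewrite /dotp (bigD1 i)//= big1 ?addr0; last first.
      by move=> j ji; rewrite mxE (negbTE ji) mul0r.
    by rewrite mxE eqxx -mulrA -normrEsg.
  apply: H; rewrite /lp_ball /= lp_norm_lt// powR1.
  rewrite (bigD1 i)//= big1 ?addr0; last first.
    by move=> j ji; rewrite mxE (negbTE ji) normr0 powR0// oner_neq0.
  rewrite powRr1// mxE eqxx normrM (gtr0_norm c0).
  by rewrite (le_lt_trans _ c1)// ler_piMr ?normr_sg_le1 ?(ltW c0).
move=> /forallP H y; rewrite /lp_ball /= lp_norm_lt// powR1.
under eq_bigr do rewrite powRr1//.
move=> H1; apply: le_trans (ltW H1); apply: ler_sum => i _.
rewrite (le_trans (ler_norm _))// normrM ler_piMr//; exact: H.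
Qed.

Lemma polar_lpoo n : polar (@lp_ball R n +oo%E) = [set x | lp_norm 1%:E x <= 1].
Proof.
apply/seteqP; split => x; rewrite /polar /= -/(lp_norm 1%:E x) lp_norm_le1//.
  move=> H; under eq_bigr do rewrite powRr1//.
  apply: ler_mul01 => [|c /andP[c0 c1]]; first exact: sumr_ge0.
  pose y : 'cV[R]_n := \col_j (c * Num.sg (x j 0)).
  have -> : c * (\sum_i `|x i 0|) = dotp y x.
    rewrite /dotp mulr_sumr; apply: eq_bigr => i _.
    by rewrite mxE -mulrA -normrEsg.
  apply: H; rewrite /lp_ball /= -/(lp_norm +oo%E y) sup_norm_lt//.
  apply/forallP => i.
  rewrite mxE normrM (gtr0_norm c0).
  by rewrite (le_lt_trans _ c1)// ler_piMr ?normr_sg_le1 ?(ltW c0).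
under eq_bigr do rewrite powRr1//.
move=> H1 y; rewrite /lp_ball /= -/(lp_norm +oo%E y) sup_norm_lt// => /forallP H.
apply: le_trans H1; apply: ler_sum => i _.
rewrite (le_trans (ler_norm _))// normrM ler_piMl// ltW//; exact: H.
Qed.

(** Hoelder's inequality is needed only for vectors of norm at most 1, where it is
    the sum of Young's inequalities over the coordinates. *)
Lemma polar_lp_conj n r s : 0 < r -> 0 < s -> r^-1 + s^-1 = 1 ->
  polar (@lp_ball R n r%:E) = [set x | lp_norm s%:E x <= 1].
Proof.
move=> r0 s0 rs.
have sr : (s - 1) * r = s.
  have : (r^-1 + s^-1) * (r * s) = r * s by rewrite rs mul1r.
  rewrite mulrDl mulKf ?gt_eqF// (mulrC r) mulKf ?gt_eqF// => H.
  by rewrite mulrBl mul1r -H addrK.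
apply/seteqP; split => x; rewrite /polar /= -/(lp_norm s%:E x) lp_norm_le1//.
  move=> H; set N := \sum_i _.
  have N0 : 0 <= N by apply: sumr_ge0 => i _; exact: powR_ge0.
  rewrite leNgt; apply/negP => N1.
  have Np : 0 < N by exact: lt_trans N1.
  suff : N `^ s^-1 <= 1.
    rewrite leNgt; apply/negP; rewrite negbK -(powR1r s^-1).
    by apply: gt0_ltr_powR; rewrite ?nnegrE// invr_gt0.
  apply: ler_mul01 => [|c /andP[c0 c1]]; first exact: powR_ge0.
  pose y : 'cV[R]_n :=
    \col_j (c * (Num.sg (x j 0) * (`|x j 0| `^ (s - 1) / N `^ r^-1))).
  have -> : c * N `^ s^-1 = dotp y x.
    have -> : N `^ s^-1 = N / N `^ r^-1.
      have -> : s^-1 = 1 - r^-1 by lra.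
      by rewrite powRB ?powRr1// (gt_eqF Np) implybT.
    rewrite /dotp mulr_suml mulr_sumr; apply: eq_bigr => i _.
    rewrite mxE -mulrA; congr (c * _).
    rewrite -[in LHS](mulr_powRB1 (normr_ge0 _) s0) {1}normrEsg.
    by ring.
  apply: H; rewrite /lp_ball /= lp_norm_lt// powR1.
  apply: (@le_lt_trans _ _ (\sum_i c `^ r * (`|x i 0| `^ s / N))).
    apply: ler_sum => i _.
    rewrite mxE !normrM (gtr0_norm c0) powRM ?(ltW c0) ?mulr_ge0//.
    rewrite ler_pM2l ?powR_gt0// powRM ?mulr_ge0//.
    rewrite normfV !(ger0_norm (powR_ge0 _ _)) powRM ?invr_ge0 ?powR_ge0//.
    rewrite -powRrM sr -powRN -powRrM mulNr mulVf ?gt_eqF// powR_inv1//.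
    rewrite ler_piMl ?mulr_ge0 ?powR_ge0 ?invr_ge0//.
    rewrite -(powR1r r); apply: ge0_ler_powR; rewrite ?nnegrE ?(ltW r0)//.
    exact: normr_sg_le1.
  rewrite -mulr_sumr -mulr_suml -/N mulfV ?gt_eqF// mulr1 -(powR1r r).
  by apply: gt0_ltr_powR; rewrite ?nnegrE// ltW.
move=> H1 y; rewrite /lp_ball /= lp_norm_lt// powR1 => H.
rewrite /dotp (@le_trans _ _ (\sum_i (`|y i 0| `^ r / r + `|x i 0| `^ s / s)))//.
  apply: ler_sum => i _; rewrite (le_trans (ler_norm _))// normrM.
  exact: conjugate_powR.
rewrite big_split /= -!mulr_suml -[leRHS]rs lerD//.
  by rewrite ler_piMl ?invr_ge0 ?ltW.
by rewrite ler_piMl ?invr_ge0// ltW.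
Qed.

Lemma polar_lp_ball n (p : \bar R) : (1 <= p)%E ->
  polar (@lp_ball R n p) = [set x | lp_norm (dual_exp p) x <= 1].
Proof.
case: p => [r| |] //=; last by rewrite polar_lpoo.
rewrite lee_fin => r1; case: eqP => [->|/eqP rN1]; first by rewrite polar_lp1.
have r1' : 0 < r - 1 by rewrite subr_gt0 lt_neqAle eq_sym rN1.
have r0 : 0 < r by exact: lt_le_trans r1.
apply: polar_lp_conj => //; first exact: divr_gt0.
by field; rewrite !gt_eqF.
Qed.

Lemma dual_exp_ge1 (p : \bar R) : (1 <= p)%E -> (1 <= dual_exp p)%E.
Proof.
case: p => [r| |] //=; rewrite lee_fin => r1; case: eqP => [_|/eqP rN1].
  by rewrite leey.
have r1' : 0 < r - 1 by rewrite subr_gt0 lt_neqAle eq_sym rN1.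
by rewrite lee_fin ler_pdivlMr// mul1r; lra.
Qed.
End Polars.

(** * The slice integral *)

Section SectionIntegral.
Context {R : realType}.
Local Notation mu := (@lebesgue_measure R).
Implicit Types (n : nat) (r t u x : R).

Lemma powR_itv01 t r : 0 < r -> 0 <= t <= 1 -> 0 <= t `^ r <= 1.
Proof.
move=> r0 /andP[t0 t1]; rewrite powR_ge0 /= -(powR1r r).
by apply: ge0_ler_powR; rewrite ?nnegrE// ltW.
Qed.

Lemma slice_factor_le1 n r t : 0 < r -> 0 <= t <= 1 -> slice_factor n r t <= 1.
Proof.
move=> r0 t01; have t0 : 0 <= t by case/andP: t01.
have /andP[? ?] := powR_itv01 r0 t01.
have /andP[? ?] : 0 <= (1 - t `^ r) `^ r^-1 <= 1.
  by apply: powR_itv01; [rewrite invr_gt0|lra].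
by rewrite /slice_factor ger0_norm// exprn_ile1.
Qed.

Lemma slice_factor_integrable n r : 0 < r ->
  mu.-integrable `[0%R, 1%R]%classic (EFin \o slice_factor n r).
Proof.
move=> r0; apply: measurable_bounded_integrable => //.
- have := lebesgue_measure_itv (`[0, 1]%R : interval R).
  by rewrite /= lte01 oppr0 adde0 => ->; exact: ltry.
- by apply/measurable_EFinP; exact: measurable_slice_factor.
- exists 1; split; [by rewrite num_real|move=> M M1 t].
  rewrite /= in_itv /= => t01.
  rewrite ger0_norm ?slice_factor_ge0//.
  exact: le_trans (slice_factor_le1 n r0 t01) (ltW M1).
Qed.

Lemma powR_continuous_pos r t : 0 < t -> {for t, continuous (@powR R ^~ r)}.
Proof.
move=> t0; apply: differentiable_continuous; apply/derivable1_diffP.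
by apply: derivable_powR; rewrite in_itv /= t0.
Qed.

Lemma slice_factor_continuous n r t : 0 < r -> 0 < t < 1 ->
  {for t, continuous (slice_factor n r)}.
Proof.
move=> r0 /andP[t0 t1].
have tr : t `^ r < 1.
  by rewrite -(powR1r r); apply: gt0_ltr_powR; rewrite ?nnegrE// ltW.
have c1 : {for t, continuous (@Num.norm R R)} by exact: norm_continuous.
have c2 : {for `|t|, continuous (@powR R ^~ r)}.
  by apply: powR_continuous_pos; rewrite normr_gt0 gt_eqF.
have c3 : {for `|t| `^ r, continuous (fun y : R => 1 - y)}.
  by apply: cvgB; [exact: cvg_cst|exact: cvg_id].
have c4 : {for 1 - `|t| `^ r, continuous (@powR R ^~ r^-1)}.
  by apply: powR_continuous_pos; rewrite gtr0_norm// subr_gt0.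
have c5 : {for (1 - `|t| `^ r) `^ r^-1, continuous (fun y : R => y ^+ n)}.
  exact: exprn_continuous.
have c14 := continuous_comp (continuous_comp (continuous_comp c1 c2) c3) c4.
exact: (continuous_comp c14 c5).
Qed.

Definition slice_integral n r : R := \int[mu]_(t in `[0, 1]) slice_factor n r t.

Lemma slice_integralE n r : 0 < r ->
  (\int[mu]_(t in `]0%R, 1%R[%classic) (slice_factor n r t)%:E =
   (slice_integral n r)%:E)%E.
Proof.
move=> r0; rewrite /slice_integral /Rintegral fineK//.
  by rewrite [RHS]integral_itv_bndoo//; exact: measurable_slice_factor.
by apply: integrable_fin_num => //; exact: slice_factor_integrable.
Qed.

Lemma slice_integral0 r : slice_integral 0 r = 1.
Proof.
rewrite /slice_integral.
have -> : \int[mu]_(t in `[0, 1]) slice_factor 0 r t =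
    \int[mu]_(t in `[0, 1]) (cst 1 t) :> R.
  by apply: eq_Rintegral => t _; rewrite /slice_factor expr0.
rewrite Rintegral_cst//.
have := lebesgue_measure_itv (`[0, 1]%R : interval R).
by rewrite /= lte01 oppr0 adde0 => ->; rewrite mul1r.
Qed.

Lemma slice_integral1 n : slice_integral n 1 = n.+1%:R^-1.
Proof.
rewrite -Rintegral_onemXn; apply: eq_Rintegral => t.
rewrite inE /= in_itv /= => /andP[t0 t1].
by rewrite /slice_factor ger0_norm// invr1 !powRr1// subr_ge0.
Qed.

Definition slice_primitive n r x : R :=
  \int[mu]_(t in `[0, x]) slice_factor n r t.

Lemma slice_primitive_ge0 n r x : 0 <= slice_primitive n r x.
Proof. by apply: Rintegral_ge0 => t _; exact: slice_factor_ge0. Qed.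

Lemma slice_primitive_le n r x : 0 < r -> x <= 1 ->
  slice_primitive n r x <= slice_integral n r.
Proof.
move=> r0 x1; have I1 := slice_factor_integrable n r0.
have sub : [set` `[0, x]] `<=` ([set` `[0, 1]] : set R).
  by apply: subset_itvl; rewrite bnd_simp.
rewrite /slice_primitive /slice_integral /Rintegral fine_le//.
- by apply: integrable_fin_num => //; exact: integrableS I1.
- exact: integrable_fin_num.
- apply: ge0_subset_integral => //; first exact: measurable_slice_factor.
  by move=> t _; rewrite lee_fin slice_factor_ge0.
Qed.

Lemma is_derive_slice_primitive n r x : 0 < r -> 0 < x < 1 ->
  is_derive x 1 (slice_primitive n r) (slice_factor n r x).
Proof.
move=> r0 /andP[x0 x1].
have cx : {for x, continuous (slice_factor n r)}.
  by apply: slice_factor_continuous; rewrite ?x0.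
have [dP dE] := continuous_FTC1_closed x1 (slice_factor_integrable n r0) x0 cx.
by rewrite -dE derive1E; exact: derivableP.
Qed.
Lemma weighted_amgm a (x y : R) : 0 < a < 1 -> 0 < x -> 0 < y ->
  x `^ a * y `^ (1 - a) <= a * x + (1 - a) * y.
Proof.
move=> /andP[a0 a1] x0 y0; have b0 : 0 < 1 - a by rewrite subr_gt0.
have := @conjugate_powR _ (x `^ a) (y `^ (1 - a)) a^-1 (1 - a)^-1
  (powR_ge0 _ _) (powR_ge0 _ _).
rewrite !invr_gt0 !invrK => /(_ a0 b0); rewrite addrC subrK => /(_ erefl).
rewrite -!powRrM !mulfV ?gt_eqF// !powRr1 ?(ltW x0) ?(ltW y0)//.
by rewrite (mulrC x) (mulrC y).
Qed.

(** In this section [a] is the inverse of the exponent of the norm and [n.+1] is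
    the dimension of the ball being sliced. *)
Section substitution.
Variables (n : nat) (a : R).
Hypothesis a01 : 0 < a < 1.

Let a0 : 0 < a. Proof. by case/andP: a01. Qed.
Let a1 : a < 1. Proof. by case/andP: a01. Qed.
Let b0 : 0 < 1 - a. Proof. by rewrite subr_gt0. Qed.

(** The transport interpolating geometrically, with weight [a], between [1 - u] and
    [1 - u ^+ n.+1], which are the tails of the probability densities 1 and
    [n.+1%:R * u ^+ n] on 0 < u < 1. *)
Definition slice_change u := (1 - u) `^ a * (1 - u ^+ n.+1) `^ (1 - a).

(** The logarithmic derivative of [slice_change], up to sign. *)
Definition slice_change_rate u :=
  a * (1 - u)^-1 + (1 - a) * (n.+1%:R * u ^+ n / (1 - u ^+ n.+1)).

Let uX u : 0 < u < 1 -> 0 < u ^+ n.+1 < 1.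
Proof. by move=> /andP[u0 u1]; rewrite exprn_gt0//= exprn_ilt1// ltW. Qed.

Lemma slice_change_itv u : 0 < u < 1 -> 0 < slice_change u < 1.
Proof.
move=> u01; have /andP[u0 u1] := u01; have /andP[m0 m1] := uX u01.
rewrite /slice_change mulr_gt0 ?powR_gt0 ?subr_gt0//=.
rewrite mulr_ilt1 ?powR_ge0//.
- rewrite -[ltRHS](powR1r a).
  by apply: gt0_ltr_powR; rewrite ?nnegrE ?ler01 ?gtrBl ?subr_ge0 ?(ltW u1).
- rewrite -[ltRHS](powR1r (1 - a)).
  by apply: gt0_ltr_powR; rewrite ?nnegrE ?gtrBl ?subr_ge0 ?(ltW m1).
Qed.

Lemma is_derive_slice_change u : 0 < u < 1 ->
  is_derive u 1 slice_change (- (slice_change u * slice_change_rate u)).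
Proof.
move=> u01; have /andP[u0 u1] := u01; have /andP[m0 m1] := uX u01.
have u10 : 0 < 1 - u by rewrite subr_gt0.
have m10 : 0 < 1 - u ^+ n.+1 by rewrite subr_gt0.
have d1 : is_derive u 1 (fun x : R => 1 - x) (-1).
  by apply: is_derive_eq; rewrite add0r mul1r.
have d2 : is_derive u 1 (fun x : R => 1 - x ^+ n.+1) (- (n.+1%:R * u ^+ n)).
  rewrite (_ : (fun x => _) = cst 1 - (@id R) ^+ n.+1); last first.
    apply/funext => x; rewrite /= [in RHS]/GRing.add/= [in RHS]/GRing.opp/=.
    by rewrite exprfctE.
  by apply: is_derive_eq; rewrite sub0r /= [_ *: _]mulr1.
have D1 : is_derive u 1 (fun x : R => (1 - x) `^ a) (a * (1 - u) `^ (a - 1) * -1).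
  exact: (@is_derive1_comp R (fun y : R => y `^ a) (fun x : R => 1 - x) u _ _
    (is_derive1_powR a u10) d1).
have D2 : is_derive u 1 (fun x : R => (1 - x ^+ n.+1) `^ (1 - a))
    ((1 - a) * (1 - u ^+ n.+1) `^ (1 - a - 1) * - (n.+1%:R * u ^+ n)).
  exact: (@is_derive1_comp R (fun y : R => y `^ (1 - a))
    (fun x : R => 1 - x ^+ n.+1) u _ _ (is_derive1_powR (1 - a) m10) d2).
have D := is_deriveM D1 D2.
have DE : is_derive u 1 slice_change _ := D.
apply: is_derive_eq.
rewrite /slice_change /slice_change_rate.
rewrite !powRB ?(gt_eqF m10) ?(gt_eqF u10) ?implybT//.
rewrite !powRr1 ?(ltW u10) ?(ltW m10)// /GRing.scale /=.
have U0 : 1 - u ^+ n.+1 != 0 by rewrite gt_eqF.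
have V0 : 1 - u != 0 by rewrite gt_eqF.
have P0 : (1 - u ^+ n.+1) `^ a != 0 by rewrite gt_eqF// powR_gt0.
move: ((1 - u ^+ n.+1) `^ a) ((1 - u) `^ a) (1 - u ^+ n.+1) (1 - u) (u ^+ n)
  U0 V0 P0 => P W U V X U0 V0 P0.
by field; rewrite U0 V0 P0.
Qed.

(** The rate is the weighted arithmetic mean of [(1 - u)^-1] and
    [n.+1%:R * u ^+ n / (1 - u ^+ n.+1)]; in the weighted geometric mean the
    denominators cancel against [slice_change u]. *)
Lemma slice_change_rate_ge u : 0 < u < 1 ->
  (n.+1%:R * u ^+ n) `^ (1 - a) <= slice_change u * slice_change_rate u.
Proof.
move=> u01; have /andP[u0 u1] := u01; have /andP[m0 m1] := uX u01.
have u10 : 0 < 1 - u by rewrite subr_gt0.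
have m10 : 0 < 1 - u ^+ n.+1 by rewrite subr_gt0.
have nu0 : 0 < n.+1%:R * u ^+ n by rewrite mulr_gt0 ?ltr0n ?exprn_gt0.
have X0 : 0 < (1 - u)^-1 by rewrite invr_gt0.
have Y0 : 0 < n.+1%:R * u ^+ n / (1 - u ^+ n.+1) by rewrite divr_gt0.
have /andP[s0 _] := slice_change_itv u01.
apply: le_trans (ler_wpM2l (ltW s0) (weighted_amgm a01 X0 Y0)).
rewrite /slice_change (powRM _ (ltW nu0)) ?invr_ge0 ?(ltW m10)//.
have powRV (x c : R) : 0 < x -> x^-1 `^ c = (x `^ c)^-1.
  by move=> x0; rewrite -(powR_inv1 (ltW x0)) -powRrM mulN1r powRN.
rewrite !powRV// le_eqVlt; apply/orP; left; apply/eqP.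
have P0 : (1 - u ^+ n.+1) `^ (1 - a) != 0 by rewrite gt_eqF// powR_gt0.
have Q0 : (1 - u) `^ a != 0 by rewrite gt_eqF// powR_gt0.
move: ((1 - u ^+ n.+1) `^ (1 - a)) ((1 - u) `^ a) P0 Q0 => P Q P0 Q0.
by field; rewrite P0 Q0.
Qed.

(** The [a^-1]-th power of [slice_change u] is [1 - u] times a number smaller
    than 1.  This is where strictness comes from. *)
Lemma slice_factor_change u : (0 < n)%N -> 0 < u < 1 ->
  (u ^+ n) `^ a < slice_factor n a^-1 (slice_change u).
Proof.
move=> n0 u01; have /andP[u0 u1] := u01; have /andP[m0 m1] := uX u01.
have /andP[s0 s1] := slice_change_itv u01.
rewrite /slice_factor invrK gtr0_norm//.
have -> : (u ^+ n) `^ a = (u `^ a) ^+ n.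
  by rewrite -(powR_mulrn n (ltW u0)) -(powR_mulrn n (powR_ge0 u a)) powRAC.
rewrite ltrXn2r ?gtn_eqF ?powR_ge0//.
apply: gt0_ltr_powR => //; rewrite ?nnegrE ?(ltW u0)//.
  have /andP[_ ?] : 0 <= slice_change u `^ a^-1 <= 1.
    by apply: powR_itv01; rewrite ?invr_gt0// !ltW.
  by rewrite subr_ge0.
rewrite /slice_change powRM ?powR_ge0// -!powRrM mulfV ?gt_eqF//.
rewrite powRr1 ?subr_ge0 ?(ltW u1)//.
rewrite ltrBrDl -ltrBrDr -[ltRHS]mulr1 ltr_pM2l ?subr_gt0//.
rewrite -[ltRHS](powR1r ((1 - a) / a)); apply: gt0_ltr_powR.
- exact: divr_gt0.
- by rewrite nnegrE subr_ge0 ltW.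
- by rewrite nnegrE.
- by rewrite gtrBl.
Qed.

Let c : R := n.+1%:R `^ (- a).

Let c_gt0 : 0 < c. Proof. by rewrite powR_gt0. Qed.

Let c_le1 : c <= 1.
Proof.
rewrite /c powRN invf_le1 ?powR_gt0// -[leLHS](powR1r a).
by apply: ge0_ler_powR; rewrite ?nnegrE ?ler1n// ltW.
Qed.

(** Substitution in differential form: [D] compares the part of the integral
    between [slice_change u] and 1, up to a constant, with the lower bound
    [c * u ^+ n.+1] sought for it.  Monotonicity of [D] replaces a change of
    variables in the integral. *)
Let D u := - slice_primitive n a^-1 (slice_change u) - c * u ^+ n.+1.

Let is_derive_D u : 0 < u < 1 -> is_derive u 1 D
  (slice_factor n a^-1 (slice_change u) * (slice_change u * slice_change_rate u)
   - c * (n.+1%:R * u ^+ n)).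
Proof.
move=> u01.
have aV : 0 < a^-1 by rewrite invr_gt0.
have D1 : is_derive u 1 (fun x => slice_primitive n a^-1 (slice_change x))
    (slice_factor n a^-1 (slice_change u) * - (slice_change u * slice_change_rate u)).
  exact: (@is_derive1_comp R (slice_primitive n a^-1) slice_change u _ _
    (is_derive_slice_primitive n aV (slice_change_itv u01))
    (is_derive_slice_change u01)).
have D2 : is_derive u 1 ((@id R) ^+ n.+1) (n.+1%:R * u ^+ n).
  by apply: is_derive_eq; rewrite /= [_ *: _]mulr1.
have D3 := is_deriveB (is_deriveN D1) (is_deriveZ c D2).
rewrite (_ : D = (- (fun x => slice_primitive n a^-1 (slice_change x))) -
    c \*: (@id R) ^+ n.+1); last first.
  apply/funext => x; rewrite /D /=.
  by rewrite [in RHS]/GRing.add/= [in RHS]/GRing.opp/= exprfctE.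
by apply: is_derive_eq; rewrite mulrN opprK.
Qed.

Hypothesis n0 : (0 < n)%N.

Let D_incr u v : 0 < u < 1 -> 0 < v < 1 -> u < v -> D u < D v.
Proof.
move=> u01 v01 uv.
have dD x : x \in `]0, 1[%R -> is_derive x 1 D
    (slice_factor n a^-1 (slice_change x) * (slice_change x * slice_change_rate x)
     - c * (n.+1%:R * x ^+ n)).
  by rewrite in_itv /=; exact: is_derive_D.
apply: (@gtr0_derive1_lt_oo _ D 0 1); rewrite ?in_itv//.
- by move=> x /dD [].
- move=> x x01; rewrite derive1E; have [_ ->] := dD _ x01.
  rewrite in_itv /= in x01; have /andP[x0 x1] := x01.
  rewrite subr_gt0 (@lt_le_trans _ _ (slice_factor n a^-1 (slice_change x) *
    (n.+1%:R * x ^+ n) `^ (1 - a)))//.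
    have -> : c * (n.+1%:R * x ^+ n) =
        (x ^+ n) `^ a * (n.+1%:R * x ^+ n) `^ (1 - a).
      have XE : (x ^+ n) `^ a * (x ^+ n) `^ (1 - a) = x ^+ n.
        have xn0 : 0 < x ^+ n by rewrite exprn_gt0.
        by rewrite -powRD ?(gt_eqF xn0) ?implybT// addrC subrK powRr1// ltW.
      have mE : n.+1%:R `^ (1 - a) = n.+1%:R * c.
        by rewrite /c powRN powRB ?pnatr_eq0 ?implybT// powRr1.
      have PM : (n.+1%:R * x ^+ n) `^ (1 - a) =
          n.+1%:R `^ (1 - a) * (x ^+ n) `^ (1 - a).
        by apply: powRM; rewrite ?exprn_ge0// ltW.
      by rewrite PM [RHS]mulrCA XE mE mulrCA mulrA.
    by rewrite ltr_pM2r ?powR_gt0 ?mulr_gt0 ?exprn_gt0// slice_factor_change.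
  by rewrite ler_wpM2l ?slice_factor_ge0// slice_change_rate_ge.
- move=> x /set_mem xI; have [dDx _] := dD _ xI.
  exact/differentiable_continuous/derivable1_diffP.
Qed.

(** [D] is strictly increasing inside the unit interval.  Near 0 it is bounded
    below by minus the integral and near 1 above by [- c], because the primitive
    lies between 0 and the integral.  The two points 1/4 and 3/4 keep the
    inequality strict in the limit. *)
Lemma slice_integral_gt : n.+1%:R `^ (- a) < slice_integral n a^-1.
Proof.
rewrite -/c.
have aV : 0 < a^-1 by rewrite invr_gt0.
have lo : - slice_integral n a^-1 <= D 4^-1.
  apply/ler_addgt0Pr => e e0; pose u := Num.min 8^-1 e.
  have ue : u <= e by rewrite ge_min lexx orbT.
  have u8 : u <= 8^-1 by rewrite ge_min lexx.
  have u0 : 0 < u by rewrite lt_min e0 andbT.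
  have uu : u ^+ n.+1 <= u by rewrite exprS ger_pMr// exprn_ile1 ?ltW//; lra.
  have u01 : 0 < u < 1 by lra.
  have Du : D u < D 4^-1 by apply: D_incr => //; lra.
  have /andP[_ s1] := slice_change_itv u01.
  have Ple := @slice_primitive_le n a^-1 (slice_change u) aV (ltW s1).
  have cu : c * u ^+ n.+1 <= u.
    by rewrite (le_trans _ uu)// ger_pMl// exprn_gt0.
  by move: Du; rewrite {1}/D => Du; lra.
have hi : c <= - D (3 / 4).
  apply: ler_mul01 => [|w /andP[w0 w1]]; first exact: ltW.
  pose v := Num.max (7 / 8) (w `^ n.+1%:R^-1).
  have wv1 : w `^ n.+1%:R^-1 < 1.
    rewrite -[ltRHS](powR1r n.+1%:R^-1).
    by apply: gt0_ltr_powR; rewrite ?nnegrE ?(ltW w0).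
  have v1 : v < 1 by rewrite gt_max wv1 andbT; lra.
  have v7 : 7 / 8 <= v by rewrite le_max lexx.
  have wv : w <= v ^+ n.+1.
    have {1}-> : w = (w `^ n.+1%:R^-1) ^+ n.+1.
      rewrite -(powR_mulrn _ (powR_ge0 _ _)) -powRrM mulVf ?pnatr_eq0//.
      by rewrite powRr1// ltW.
    have v0 : 0 <= v by lra.
    by rewrite lerXn2r ?nnegrE ?powR_ge0// /v le_max lexx orbT.
  have Dv : D (3 / 4) < D v by apply: D_incr; lra.
  have P0 := slice_primitive_ge0 n a^-1 (slice_change v).
  have cw : w * c <= c * v ^+ n.+1 by rewrite mulrC ler_pM2l.
  by move: Dv; rewrite {2}/D => Dv; lra.
have : D 4^-1 < D (3 / 4) by apply: D_incr; lra.
by move=> ?; lra.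
Qed.

End substitution.
End SectionIntegral.

(** * Volume products of dual balls *)

Section BallProducts.
Context {R : realType}.
Local Notation mu := (@lebesgue_measure R).
Implicit Types (n : nat) (r : R).

Lemma slice_integral_ge n r : 1 <= r ->
  n.+1%:R `^ (- r^-1) <= slice_integral n r.
Proof.
rewrite le_eqVlt => /predU1P[<-|r1].
  by rewrite slice_integral1 invr1 powR_inv1.
case: n => [|n]; first by rewrite slice_integral0 powR1r.
have r0 : 0 < r by exact: lt_trans r1.
rewrite -[in leRHS](invrK r) ltW// slice_integral_gt// invr_gt0 r0 /=.
by rewrite invf_lt1.
Qed.

Lemma vol_lp_ball_prod n r : 1 <= r ->
  vol (@lp_ball R n r%:E) = (2 ^+ n * \prod_(k < n) slice_integral k r)%:E.
Proof.
move=> r1; have r0 : 0 < r by exact: lt_le_trans r1.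
elim: n => [|n IH].
  rewrite big_ord0 expr0 mulr1 (_ : lp_ball _ = setT).
    by rewrite /vol /= diracT.
  apply/seteqP; split => // x _; rewrite /lp_ball /= big_ord0.
  by rewrite powR0 ?ltr01// invr_eq0 gt_eqF.
rewrite vol_lp_ballS// IH integral_slice_factor slice_integralE//.
rewrite -!EFinM big_ord_recr /=.
by congr EFin; rewrite exprS; ring.
Qed.

Lemma vol_sup_ball n : vol (@lp_ball R n +oo%E) = (2 ^+ n)%:E.
Proof.
elim: n => [|n IH].
  rewrite expr0 (_ : lp_ball _ = setT); first by rewrite /vol /= diracT.
  by apply/seteqP; split => // x _; rewrite /lp_ball /= big_ord0 ltr01.
transitivity (\int[mu]_(t in `](-1)%R, 1%R[%classic) (cst (2 ^+ n)%:E t))%E.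
  rewrite vol_integral_head [RHS]integral_mkcond; apply: eq_integral => t _.
  rewrite patchE mem_setE in_itv /= -ltr_norml -IH.
  case: ifPn => t1.
    congr vol; apply/funext => y; rewrite /lp_ball; apply/propext.
    split=> /=; rewrite -/(lp_norm +oo%E y) -/(lp_norm +oo%E (col_cons t y))
      !sup_norm_lt//.
      move=> /forallP H; apply/forallP => i.
      by have := H (rshift 1 i : 'I_(1 + n)); rewrite /col_cons col_mxEd.
    move=> /forallP H; apply/forallP => i.
    rewrite -[i](@splitK 1 n); case: (fintype.split (i : 'I_(1 + n))) => k /=.
      by rewrite /col_cons col_mxEu ord1 mxE eqxx.
    by rewrite /col_cons col_mxEd.
  rewrite (_ : [set _ | _] = set0) ?vol0//.
  apply/seteqP; split => // y; rewrite /lp_ball /=.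
  rewrite -/(lp_norm +oo%E (col_cons t y)) sup_norm_lt// => /forallP H.
  have := H (lshift n ord0 : 'I_(1 + n)).
  by rewrite /col_cons col_mxEu mxE eqxx (negbTE t1).
rewrite integral_cst//.
have := lebesgue_measure_itv (`](-1), 1[%R : interval R).
rewrite /= lte_fin (_ : -1 < 1); last by lra.
by move=> ->; rewrite -EFinD -EFinM exprSr opprK.
Qed.

Lemma prod_slice_integral_ge n r : 1 <= r ->
  n`!%:R `^ (- r^-1) <= \prod_(k < n) slice_integral k r.
Proof.
move=> r1; elim: n => [|n IH]; first by rewrite big_ord0 fact0 powR1r.
rewrite big_ord_recr /= factS mulnC natrM powRM//.
by rewrite ler_pM ?powR_ge0// slice_integral_ge.
Qed.

Lemma prod_slice_integral_gt n r : (2 <= n)%N -> 1 < r ->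
  n`!%:R `^ (- r^-1) < \prod_(k < n) slice_integral k r.
Proof.
case: n => [//|[//|n]] _ r1; have r0 : 0 < r by exact: lt_trans r1.
have H := prod_slice_integral_ge n.+1 (ltW r1).
rewrite big_ord_recr /= (factS n.+1) mulnC natrM powRM//.
have S0 : 0 < slice_integral n.+1 r.
  by apply: lt_le_trans (slice_integral_ge n.+1 (ltW r1)); rewrite powR_gt0.
apply: (@lt_le_trans _ _ (n.+1`!%:R `^ (- r^-1) * slice_integral n.+1 r)).
  rewrite ltr_pM2l ?powR_gt0 ?ltr0n ?fact_gt0//.
  rewrite -[in ltRHS](invrK r) slice_integral_gt// invr_gt0 r0 /=.
  by rewrite invf_lt1.
by rewrite ler_pM2r.
Qed.

Lemma prod_slice_integral1 n :
  \prod_(k < n) slice_integral k 1 = n`!%:R^-1 :> R.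
Proof.
elim: n => [|n IH]; first by rewrite big_ord0 fact0 invr1.
by rewrite big_ord_recr /= IH slice_integral1 factS mulnC natrM invfM.
Qed.

Lemma vol_lp_dual1 n : (vol (@lp_ball R n 1%E) * vol (@lp_ball R n +oo%E) =
  (4 ^+ n / n`!%:R)%:E)%E.
Proof.
rewrite vol_lp_ball_prod// vol_sup_ball -EFinM prod_slice_integral1; congr EFin.
by rewrite mulrAC -exprMn; congr (_ ^+ n / _); lra.
Qed.

Lemma vol_lp_dual_gt n r s : (2 <= n)%N -> 1 < r -> 1 < s -> r^-1 + s^-1 = 1 ->
  ((4 ^+ n / n`!%:R)%:E < vol (@lp_ball R n r%:E) * vol (@lp_ball R n s%:E))%E.
Proof.
move=> n2 r1 s1 rs.
rewrite (vol_lp_ball_prod n (ltW r1)) (vol_lp_ball_prod n (ltW s1)).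
rewrite -EFinM lte_fin mulrACA -exprMn.
have -> : 2 * 2 = 4 :> R by lra.
rewrite ltr_pM2l ?exprn_gt0//.
have f0 : 0 < n`!%:R :> R by rewrite ltr0n fact_gt0.
have -> : n`!%:R^-1 = n`!%:R `^ (- r^-1) * n`!%:R `^ (- s^-1) :> R.
  by rewrite -powRD ?(gt_eqF f0) ?implybT// -opprD rs powR_inv1.
by rewrite ltr_pM ?powR_ge0// prod_slice_integral_gt.
Qed.
End BallProducts.

Theorem theorem4p1 (R : realType) (n : nat) (p : \bar R) (hp : (1 <= p)%E)
    (Y : 'M[R]_n) (hY : Y \in unitmx)
    (Q : set 'cV[R]_n) (hQ : Q = [set Y *m x | x in @lp_ball R n p]) :
  (n = 1%N ->
     vol (cprod Q (polar Q)) = (vol Q * vol (polar Q))%E /\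
     (vol Q * vol (polar Q))%E = 4%:E) /\
  ((2 <= n)%N ->
     [/\ vol (cprod Q (polar Q)) = (vol Q * vol (polar Q))%E,
         ((4 ^+ n / (n`!)%:R)%:E <= vol Q * vol (polar Q))%E
       & (vol Q * vol (polar Q))%E = (4 ^+ n / (n`!)%:R)%:E <->
         p = 1%E \/ p = +oo%E]).
Proof.
set q := dual_exp p.
have QE : Q = [set x | lp_ball p (invmx Y *m x + 0)].
  rewrite hQ; apply/seteqP; split => [_ [x Bx <-]|x /= Bx].
    by rewrite /= addr0 mulKmx.
  by exists (invmx Y *m x); rewrite ?mulKVmx// -[_ *m _]addr0.
have PE : polar Q = [set x | lp_norm q (Y^T *m x + 0) <= 1].
  have := polar_lp_ball n hp; rewrite -/q => pE.
  apply/seteqP; split => x.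
    move=> Px; rewrite /= addr0.
    suff : polar (lp_ball p) (Y^T *m x) by rewrite pE.
    by move=> y By; rewrite -dotp_adjoint; apply: Px; rewrite hQ; exists y.
  rewrite /= addr0 => Nx y; rewrite hQ => -[z Bz <-]; rewrite dotp_adjoint.
  suff : polar (lp_ball p) (Y^T *m x) by exact.
  by rewrite pE.
have mB : measurable_col (@lp_ball R n p) by exact: measurable_col_lp_lt.
have mC : measurable_col [set x : 'cV[R]_n | lp_norm q x <= 1].
  exact: measurable_col_lp_le.
have mQ : measurable_col Q by rewrite QE; exact: measurable_col_affine.
have mP : measurable_col (polar Q).
  by rewrite PE; exact: measurable_col_affine mC.
have prodE : (vol Q * vol (polar Q) =
    vol (@lp_ball R n p) * vol (@lp_ball R n q))%E.
  have uYV : invmx Y \in unitmx by rewrite unitmx_inv.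
  have uYT : Y^T \in unitmx by rewrite unitmx_tr.
  rewrite -(vol_closed_lp_ball n (dual_exp_ge1 hp)) -/q.
  rewrite -(vol_affine 0 uYV mB) -(vol_affine 0 uYT mC) -QE -PE muleACA -EFinM.
  by rewrite det_tr det_inv -normrM mulVr ?normr1 ?mul1e.
rewrite vol_cprod// prodE; split => [n1|n2].
  split => //; rewrite n1 /q.
  have V1 (s : \bar R) : (1 <= s)%E -> vol (@lp_ball R 1 s) = 2%:E.
    case: s => [s| |] //; rewrite ?lee_fin => s1; last by rewrite vol_sup_ball.
    by rewrite vol_lp_ball_prod// big_ord1 slice_integral0 mulr1.
  by rewrite !V1 ?dual_exp_ge1// -EFinM; congr EFin; lra.
have [p1|p1] := eqVneq p 1%E.
  by rewrite /q p1 /= eqxx vol_lp_dual1; split => //; split => // _; left.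
have [poo|poo] := eqVneq p +oo%E.
  by rewrite /q poo /= muleC vol_lp_dual1; split => //; split => // _; right.
have H : ((4 ^+ n / n`!%:R)%:E < vol (@lp_ball R n p) * vol (@lp_ball R n q))%E.
  rewrite /q; case: p hp p1 poo {q hQ QE PE mB mC prodE} => [r| |] //=.
  rewrite lee_fin => r1; rewrite eqe => rN1 _; rewrite (negbTE rN1).
  have r1' : 1 < r by rewrite lt_neqAle eq_sym rN1.
  have rm : 0 < r - 1 by rewrite subr_gt0.
  apply: vol_lp_dual_gt => //.
    by rewrite ltr_pdivlMr// mul1r; lra.
  by field; rewrite !gt_eqF//; lra.
split => //; first exact: ltW.
split => [E|[pE|pE]]; first by rewrite E ltxx in H.
  by rewrite pE eqxx in p1.
by rewrite pE eqxx in poo.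
Qed.
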